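(* Let $H=\bigotimes_{i=1}^N H_i$ be a Hilbert space with $\dim H_i=d_i$, and let $\rho$ and $\rho'$ be two $N$-partite mixed states over $H$, with coefficient tensors $\mathcal{X}$ and $\mathcal{X}'$ and mode-$i$ matricizations $X_{(i)}$ and $X'_{(i)}$ respectively. If $\rho$ and $\rho'$ are SLOCC equivalent, then for every $i=1,\dots,N$, writing $D_i=\prod_{l\neq i}d_l^2$, there are $d_i^2\times d_i^2$ unitary matrices $P^{(1)}_i,P^{(2)}_i$, $D_i\times D_i$ unitary matrices $Q^{(1)}_i,Q^{(2)}_i$, and invertible diagonal matrices $S_1$ (of size $d_i^2\times d_i^2$) and $S_2$ (of size $D_i\times D_i$) such that $$X'_{(i)}=P^{(1)}_iS_1(P^{(2)}_i)^{\dagger}X_{(i)}(Q^{(2)}_i)^{\dagger}S_2Q^{(1)}_i$$ and $$\operatorname{rank}\Bigl(R\Bigl(\bigl((Q^{(2)}_i)^{\dagger}S_2Q^{(1)}_i\bigr)_{j|\widehat j}\Bigr)\Bigr)=1\qquad\text{for all } j\in\{1,\dots,N\},\ j\neq i.$$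
   Context: The $H_i$ are finite-dimensional complex Hilbert spaces with fixed orthonormal bases; a mixed state is a density matrix (positive semidefinite, trace one) on $H$. Two mixed states $\rho,\rho'$ are SLOCC equivalent if $\rho'=(M_1\otimes\cdots\otimes M_N)\rho(M_1\otimes\cdots\otimes M_N)^{\dagger}$ for some $M_i\in GL(d_i,\mathbb{C})$. Coefficient tensor of a mixed state: for each $k$ let $\lambda^{(k)}_0=\mathrm{I}_{d_k}$ and let $\lambda^{(k)}_1,\dots,\lambda^{(k)}_{d_k^2-1}$ be the (generalized) Gell-Mann matrices of size $d_k$ (traceless Hermitian with $\mathrm{Tr}(\lambda^{(k)}_a\lambda^{(k)}_b)=2\delta_{ab}$). The coefficient tensor of $\rho$ is the real array $\mathcal{X}=(x_{i_1\cdots i_N})$ of size $d_1^2\times\cdots\times d_N^2$ uniquely determined by $$\rho=\sum_{i_1=1}^{d_1^2}\cdots\sum_{i_N=1}^{d_N^2}x_{i_1\cdots i_N}\,\lambda^{(1)}_{i_1-1}\otimes\cdots\otimes\lambda^{(N)}_{i_N-1}.$$ The mode-$n$ matricization $X_{(n)}$ of this tensor is the $d_n^2\times D_n$ matrix whose $(i_n,j)$ entry is $x_{i_1\cdots i_N}$, where $j=1+\sum_{k\neq n}(i_k-1)\beta_k$ and $\beta_k=\prod_{m<k,\ m\neq n}d_m^2$. Realignment: for a matrix $Y$, $\mathrm{vec}(Y)$ is the column vector obtained by stacking the columns of $Y$. For an $m\times m$ block matrix $Z=(Z_{pq})$ with blocks of size $n\times n$, $R(Z)=[\mathrm{vec}(Z_{11}),\dots,\mathrm{vec}(Z_{m1}),\dots,\mathrm{vec}(Z_{1m}),\dots,\mathrm{vec}(Z_{mm})]^{\mathrm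 t}$, an $m^2\times n^2$ matrix. Bipartite partition: rows and columns of a $D_i\times D_i$ matrix $Q$ are indexed by multi-indices $(k_l)_{l\neq i}$, $1\le k_l\le d_l^2$, listed in the same order as the columns of $X_{(i)}$. For $j\neq i$, $Q_{j|\widehat j}$ is $Q$ regarded as a $d_j^2\times d_j^2$ block matrix whose $(p,q)$ block consists of the entries with row index $k_j=p$ and column index $k_j=q$, rows and columns inside the block being indexed by the remaining indices $(k_l)_{l\neq i,j}$ in a fixed common order. *)

(* Defs.v *)
From HB Require Import structures.
From mathcomp Require Import all_boot all_order all_algebra.
From mathcomp Require Import complex mxtens reals.

Set Implicit Arguments.
Unset Strict Implicit.
Unset Printing Implicit Defensive.

Import Order.TTheory GRing.Theory Num.Theory.

Local Open Scope ring_scope.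
Local Open Scope sesquilinear_scope.

Section MultiIndex.
Variables (N : nat) (e : 'I_N -> nat).
Implicit Types (P : pred 'I_N) (i j k : 'I_N).
Local Open Scope nat_scope.

Definition midx := {dffun forall k : 'I_N, 'I_(e k)}.

Definition upd (I : midx) n (a : 'I_(e n)) : midx := [ffun k => dfwith I a k].

(* Multi-indices restricted to the modes in P are numbered in mixed radix, the
   smallest mode varying fastest; everything is 0-based. *)
Definition place P (n : nat) := \prod_(m < N | P m && (m < n)) e m.

Definition code P (I : midx) := \sum_(k < N | P k) I k * place P k.

Lemma big_place_recr x0 (op : Monoid.com_law x0) P (F : 'I_N -> nat) k :
  \big[op/x0]_(m < N | P m && (m < k.+1)) F m =
    op (if P k then F k else x0) (\big[op/x0]_(m < N | P m && (m < k)) F m).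
Proof.
have ltE (m : 'I_N) : (m < k.+1) && (m != k :> nat) = (m < k).
  by rewrite ltnS [RHS]ltn_neqAle andbC.
have [Pk|nPk] := boolP (P k).
  rewrite (bigD1 k) ?Pk ?ltnS //=; congr (op _ _).
  by apply: eq_bigl => m; rewrite -andbA ltE.
rewrite Monoid.mul1m; apply: eq_bigl => m; rewrite -ltE.
case: (eqVneq (m : nat) k) => [/val_inj->|_]; last by rewrite andbT.
by rewrite (negbTE nPk).
Qed.

Definition coden P (I : midx) n :=
  \sum_(k < N | P k && (k < n)) I k * place P k.

Lemma coden_ltn P (I : midx) n : n <= N -> coden P I n < place P n.
Proof.
elim: n => [_|n IHn ltnN].
  by rewrite /coden /place !big_pred0 // => k; rewrite ltn0 andbF.
have {}IHn := IHn (ltnW ltnN); rewrite /coden /place.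
rewrite !(big_place_recr _ _ _ (Ordinal ltnN)) /= -/(place P n) -/(coden P I n).
case: ifP => Pn; last by rewrite add0n mul1n.
rewrite addnC; apply: leq_trans (_ : (I (Ordinal ltnN)).+1 * place P n <= _).
  by rewrite mulSn ltn_add2r.
by rewrite leq_mul2r ltn_ord orbT.
Qed.

Lemma andb_ltn_ord P (k : 'I_N) : P k && (k < N) = P k.
Proof. by rewrite ltn_ord andbT. Qed.

Lemma place_N P : place P N = \prod_(k < N | P k) e k.
Proof. exact: (eq_bigl _ _ (andb_ltn_ord P)). Qed.

Lemma codenN P I : coden P I N = code P I.
Proof. exact: (eq_bigl _ _ (andb_ltn_ord P)). Qed.

Lemma code_ltn P (I : midx) : code P I < \prod_(k < N | P k) e k.
Proof. by rewrite -codenN -place_N coden_ltn. Qed.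

Definition encode P (I : midx) : 'I_(\prod_(k < N | P k) e k) :=
  Ordinal (code_ltn P I).

Hypothesis e_gt0 : forall k, 0 < e k.

(* Inverse of encode on the modes in P; the components of decode P c outside P
   are irrelevant. *)
Definition decode P (c : 'I_(\prod_(k < N | P k) e k)) : midx :=
  [ffun k : 'I_N => Ordinal (ltn_pmod (c %/ place P k) (e_gt0 k))].

Lemma decodeK P : cancel (@decode P) (encode P).
Proof.
move=> c; apply/val_inj => /=.
suff H n : n <= N -> coden P (decode c) n = c %% place P n.
  by rewrite -codenN H // place_N modn_small.
elim: n => [_|n IHn ltnN].
  have p0 (k : 'I_N) : P k && (k < 0) = false by rewrite ltn0 andbF.
  by rewrite /coden /place !(eq_bigl _ _ p0) !big_pred0_eq modn1.
have {}IHn := IHn (ltnW ltnN); rewrite /coden /place.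
rewrite !(big_place_recr _ _ _ (Ordinal ltnN)) /= -/(place P n) -/(coden P _ n).
case: ifP => Pn; last by rewrite add0n mul1n.
rewrite IHn ffunE /= -/(place P n).
set k := Ordinal ltnN; set b := place P n.
by rewrite modn_divl [RHS](divn_eq _ b) modn_dvdm ?dvdn_mull.
Qed.

Lemma encodeK P I k : P k -> decode (encode P I) k = I k.
Proof.
move=> Pk; apply/val_inj; rewrite ffunE /=.
have Ek1 : place P k.+1 = e k * place P k.
  by rewrite /place big_place_recr Pk.
have Ck1 : coden P I k.+1 = I k * place P k + coden P I k.
  by rewrite /coden big_place_recr Pk.
have dvd_place n m : n <= m -> place P n %| place P m.
  move=> le_nm; rewrite /place [X in _ %| X](bigID (fun l : 'I_N => l < n)).
  suff -> : \prod_(l < N | P l && (l < n)) e l =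
            \prod_(l < N | (P l && (l < m)) && (l < n)) e l by exact: dvdn_mulr.
  apply: eq_bigl => l; case: (ltnP l n) => ln; rewrite ?andbF //.
  by rewrite (leq_trans ln le_nm) !andbT.
have codemod : code P I %% place P k.+1 = coden P I k.+1.
  rewrite /code (bigID (fun l : 'I_N => l < k.+1)) /= -/(coden P I k.+1).
  set rest := (X in (_ + X) %% _).
  have /dvdnP[q ->] : place P k.+1 %| rest.
    apply: dvdn_sum => l /andP[_]; rewrite -leqNgt => kl.
    exact: dvdn_mull (dvd_place _ _ kl).
  by rewrite addnC modnMDl modn_small ?coden_ltn.
have b0 : 0 < place P k by apply: prodn_cond_gt0.
rewrite modn_divl -Ek1 codemod Ck1 divnMDl //.
by rewrite divn_small ?addn0 // coden_ltn // ltnW.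
Qed.

(* x_I is the (I n, encode I) entry, where encode ranges over the modes other
   than n. *)
Definition matricization (T : Type) (x : midx -> T) n :
    'M[T]_(e n, \prod_(k < N | k != n) e k) :=
  \matrix_(a, c) x (upd (decode c) a).

(* Q is indexed by the modes other than i, block (p, q) fixes the j-th row and
   column components to p and q, and the blocks are indexed by the modes other
   than i and j. *)
Definition bipartition (T : Type) i j
    (Q : 'M[T]_(\prod_(k < N | k != i) e k)) :
    'M[T]_(\sum_(p < e j) \prod_(k < N | (k != i) && (k != j)) e k) :=
  \mxblock_(p < e j, q < e j)
    \matrix_(r, s) Q (encode (fun k => k != i) (upd (decode r) p))
                     (encode (fun k => k != i) (upd (decode s) q)).

End MultiIndex.

Section Realignment.
Variable T : Type.

(* mxtens_unindex c = (c %/ m, c %% m): the second component varies fastest, so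
   columns are stacked, and blocks are listed in column-major order. *)
Definition vec m n (Y : 'M[T]_(m, n)) : 'cV[T]_(n * m) :=
  \col_c (let: (t, s) := mxtens_unindex c in Y s t).

Definition realign m n (Z : 'M[T]_(\sum_(p < m) n)) : 'M[T]_(m * m, n * n) :=
  \matrix_(k < m * m)
    (let: (q, p) := mxtens_unindex k in (vec (submxblock Z p q))^T).

End Realignment.

Section States.
Variable R : realType.

Definition density n (rho : 'M[R[i]]_n) : Prop :=
  [/\ rho^t* = rho,
      forall v : 'cV[R[i]]_n, 0 <= (v^t* *m rho *m v) 0 0
    & \tr rho = 1].

(* Generalized Gell-Mann matrices, preceded by the identity.  The index
   a = p * d + q stands for the pair (p, q): symmetric matrices for p < q,
   antisymmetric ones for q < p, diagonal ones for p = q > 0, the identity for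
   p = q = 0.  For d = 2 this lists 1, sigma_x, sigma_y, sigma_z. *)
Definition gell_mann d (a : 'I_(d ^ 2)) : 'M[R[i]]_d :=
  let p := (a %/ d)%N in
  let q := (a %% d)%N in
  let E s t : 'M[R[i]]_d :=
    \matrix_(u, v) ((u == s :> nat) && (v == t :> nat))%:R in
  if a == 0%N :> nat then 1%:M
  else if (p < q)%N then E p q + E q p
  else if (q < p)%N then 'i *: (E p q - E q p)
  else sqrtC (2 / (p * p.+1)%:R) *: (\sum_(s < p) E s s - p%:R *: E p p).

Variables (N : nat) (d : 'I_N -> nat).
Hypothesis d_gt0 : forall k, (0 < d k)%N.

(* The basis vectors of the tensor product are numbered by encode over all
   modes. *)
Definition tensor (A : forall k : 'I_N, 'M[R[i]]_(d k)) :
    'M[R[i]]_(\prod_(k < N) d k) :=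
  \matrix_(s, t) \prod_(k < N) A k (decode d_gt0 s k) (decode d_gt0 t k).

Definition slocc (rho rho' : 'M[R[i]]_(\prod_(k < N) d k)) : Prop :=
  exists M : forall k : 'I_N, 'M[R[i]]_(d k),
    (forall k, M k \in unitmx) /\
    rho' = tensor M *m rho *m (tensor M)^t*.

Definition dsq (k : 'I_N) : nat := (d k ^ 2)%N.

Lemma dsq_gt0 k : (0 < dsq k)%N. Proof. by rewrite expn_gt0 d_gt0. Qed.

Definition coef_tensor (rho : 'M[R[i]]_(\prod_(k < N) d k))
    (x : midx dsq -> R) : Prop :=
  rho = \sum_(I : midx dsq)
          (x I)%:C%C *: tensor (fun k => gell_mann (I k : 'I_(d k ^ 2))).

End States.

(* Main.v *)
Require Import Defs.
From mathcomp Require Import all_boot all_order all_algebra.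
From mathcomp Require Import complex mxtens reals.
Import Order.TTheory GRing.Theory Num.Theory.
Local Open Scope ring_scope.
Local Open Scope sesquilinear_scope.

(* Conjugation [A |-> M_k A M_k^*] is invertible on matrices, so its matrix T_k
   in the Gell-Mann basis is invertible, and the coefficient tensors satisfy
   x' = (T_1 (x) ... (x) T_N) x.  Hence X'_(i) = T_i X_(i) K^T, where K is the
   Kronecker product of the T_k for k <> i.  Both T_i and K^T are written through
   their singular value decompositions.  Since K^T is itself the product of the
   two singular value factors and is a Kronecker product, splitting off the j-th
   factor makes its realignment a nonzero column times a nonzero row. *)

(** * Kronecker products over a set of modes *)

Section Kronecker.
Variables (F : comNzRingType) (N : nat) (e : 'I_N -> nat).
Hypothesis e_gt0 : forall k, (0 < e k)%N.
Implicit Type P : pred 'I_N.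

(** Distributivity is first obtained for families in [fprod]; the bijection [dffun_of_fprod] carries
    it over to multi-indices. *)
Lemma midx_distr (G : forall k, 'I_(e k) -> F) :
  \prod_k \sum_a G k a = \sum_(I : midx e) \prod_k G k (I k).
Proof.
pose G' k : {ffun 'I_(e k) -> F} := [ffun a => G k a].
rewrite (reindex (@dffun_of_fprod _ (fun k => 'I_(e k)))); last first.
  exact/onW_bij/dffun_of_fprod_bij.
transitivity (\sum_(t : fprod (fun k => 'I_(e k)))
  \prod_(k in 'I_N) G' k (t k)); last first.
  by apply: eq_bigr => t _; apply: eq_bigr => k _; rewrite !ffunE.
rewrite big_fprod -(bigA_distr_big_dep _ (fun k => untag 0 (G' k))).
apply: eq_bigr => k _.
rewrite -(big_tag (fun k => G' k : 'I_(e k) -> F) k).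
by apply: eq_bigr => a _; rewrite ffunE.
Qed.

Lemma eq_encode P (I J : midx e) :
  (forall k, P k -> I k = J k) -> encode P I = encode P J.
Proof. by move=> IJ; apply/val_inj/eq_bigr => k Pk; rewrite IJ. Qed.

Lemma updE (I : midx e) n (a : 'I_(e n)) : upd I a n = a.
Proof. by rewrite ffunE dfwith_in. Qed.

Lemma updNE (I : midx e) n (a : 'I_(e n)) k : k != n -> upd I a k = I k.
Proof. by move=> kn; rewrite ffunE dfwith_out // eq_sym. Qed.

(** Outside [P] each factor is replaced by the indicator of index 0, whose sum is 1. This reduces
    the claim to [midx_distr], where only multi-indices that are 0 outside [P] contribute, and these
    correspond to codes. *)
Lemma encode_cond_distr P (G : forall k, 'I_(e k) -> F) :
  \prod_(k | P k) \sum_a G k a =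
  \sum_(c < \prod_(k < N | P k) e k) \prod_(k | P k) G k (decode e_gt0 c k).
Proof.
pose z k : 'I_(e k) := Ordinal (e_gt0 k).
pose G' k a := if P k then G k a else (a == z k)%:R.
transitivity (\prod_k \sum_a G' k a).
  rewrite big_mkcond; apply: eq_bigr => k _; rewrite /G'; case: (P k) => //.
  by rewrite (bigD1 (z k)) // eqxx big1 /= ?addr0 // => a /negbTE->.
rewrite midx_distr.
(* [decode] leaves arbitrary components outside [P]; resetting them to 0 makes [f] inverse to
   [encode] on the surviving multi-indices. *)
pose f (c : 'I_(\prod_(k < N | P k) e k)) : midx e :=
  [ffun k => if P k then decode e_gt0 c k else z k].
rewrite (bigID (fun I : midx e => [forall k, P k || (I k == z k)])) /=.
rewrite [X in _ + X]big1 ?addr0 => [|I /forallPn[k]]; last first.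
  rewrite negb_or => /andP[/negbTE nPk /negbTE Ik].
  by rewrite (bigD1 k) //= /G' nPk Ik mul0r.
rewrite (reindex f) /=; last first.
  exists (encode P) => [c _|I /forallP HI].
    rewrite -[RHS](decodeK e_gt0); apply: eq_encode => k Pk.
    by rewrite ffunE Pk.
  apply/ffunP => k; rewrite ffunE; case: ifPn => Pk; first by rewrite encodeK.
  by have := HI k; rewrite (negbTE Pk) => /eqP.
apply: eq_big => [c|c _].
  by apply/forallP => k; rewrite ffunE; case: (P k).
rewrite [RHS]big_mkcond /=; apply: eq_bigr => k _.
by rewrite /G' ffunE; case: (P k); rewrite ?eqxx.
Qed.

(** The operator [tensor] is the case where [P] holds everywhere, so [kronM] serves both the states
    and the coefficient tensors. *)
Definition kron P (A : forall k, 'M[F]_(e k)) :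
    'M[F]_(\prod_(k < N | P k) e k) :=
  \matrix_(s, t) \prod_(k | P k) A k (decode e_gt0 s k) (decode e_gt0 t k).

Lemma kronM P A B : kron P A *m kron P B = kron P (fun k => A k *m B k).
Proof.
apply/matrixP => s t; rewrite !mxE.
under [RHS]eq_bigr do rewrite mxE.
rewrite encode_cond_distr; apply: eq_bigr => c _.
by rewrite !mxE -big_split.
Qed.

Lemma kron1 P : kron P (fun k => 1%:M) = 1%:M.
Proof.
apply/matrixP => s t; rewrite !mxE.
have [->|st] := eqVneq s t; first by apply: big1 => k _; rewrite mxE eqxx.
have [k /andP[Pk /negbTE kst]] :
    exists k, P k && (decode e_gt0 s k != decode e_gt0 t k).
  apply/existsP; apply: contraR st => /existsPn H.
  rewrite -[s](decodeK e_gt0) -[t](decodeK e_gt0); apply/eqP/eq_encode => k Pk.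
  by have := H k; rewrite Pk negbK => /eqP.
by rewrite (bigD1 k) //= mxE kst mul0r.
Qed.

End Kronecker.

Arguments kron {F N e} e_gt0 P A.

Lemma kron_unit (F : comUnitRingType) N (e : 'I_N -> nat)
    (e_gt0 : forall k, (0 < e k)%N) (P : pred 'I_N)
    (A : forall k, 'M[F]_(e k)) :
  (forall k, A k \in unitmx) -> kron e_gt0 P A \in unitmx.
Proof.
move=> uA; suff /mulmx1_unit[] :
  kron e_gt0 P A *m kron e_gt0 P (fun k => invmx (A k)) = 1%:M by [].
rewrite kronM -(kron1 _ _ _ e_gt0 P); apply/matrixP => s t; rewrite !mxE.
by apply: eq_bigr => k _; rewrite mulmxV.
Qed.

(** * Singular value decomposition of an invertible matrix *)

(** Diagonalise the Gram matrix [A^t* *m A] as [V^t* *m diag_mx D *m V]. Invertibility makes [D]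
    positive, so [S] is its square root, and the left factor [A *m V^t* *m S^-1] is unitary because
    its Gram matrix is [S^-1 D S^-1 = 1]. *)
Lemma unitmx_svd (C : numClosedFieldType) n (A : 'M[C]_n) : A \in unitmx ->
  exists P S V : 'M[C]_n, [/\ P \is unitarymx, V \is unitarymx,
    is_diag_mx S, S \in unitmx & A = P *m S *m V].
Proof.
move=> uA; set H := A^t* *m A.
have HH : H^t* = H by rewrite trmx_mul map_mxM trmxCK.
have /orthomx_spectralP : H \is normalmx by apply/normalmxP; rewrite HH.
set V := spectralmx H; set D := spectral_diag H => HE.
have Vu : V \is unitarymx := spectral_unitarymx H.
have VV : V *m V^t* = 1%:M by apply/unitarymxP.
have VV' : V^t* *m V = 1%:M by apply: mulmx1C.
have DE : (A *m V^t*)^t* *m (A *m V^t*) = diag_mx D.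
  rewrite trmx_mul map_mxM trmxCK !mulmxA -[_ *m A^t* *m A]mulmxA -/H HE.
  rewrite invmx_unitary //.
  by rewrite !mulmxA VV mul1mx -mulmxA VV mulmx1.
have D_ge0 k : 0 <= D 0 k.
  have := congr1 (fun X : 'M_n => X k k) DE; rewrite !mxE eqxx mulr1n => <-.
  by apply: sumr_ge0 => j _; rewrite !mxE mulrC mul_conjC_ge0.
have uD : diag_mx D \in unitmx.
  rewrite -DE !unitmx_mul map_unitmx unitmx_tr !unitmx_mul uA.
  by rewrite map_unitmx unitmx_tr unitarymx_unit.
have D_neq0 k : D 0 k != 0.
  move: uD; rewrite unitmxE det_diag unitfE => /prodf_neq0; exact.
pose S := diag_mx (\row_k sqrtC (D 0 k)).
pose S' := diag_mx (\row_k (sqrtC (D 0 k))^-1).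
have SS : S *m S' = 1%:M.
  rewrite mulmx_diag -[1%:M]diag_const_mx.
  congr diag_mx; apply/rowP => k; rewrite !mxE.
  by rewrite mulfV // sqrtC_eq0.
have SS' : S' *m S = 1%:M by apply: mulmx1C.
have S'D : S' *m diag_mx D *m S' = 1%:M.
  rewrite !mulmx_diag -[1%:M]diag_const_mx.
  congr diag_mx; apply/rowP => k; rewrite !mxE.
  by rewrite -{2}[D 0 k]sqrtCK expr2 mulKf ?sqrtC_eq0 // mulfV ?sqrtC_eq0.
have S'h : S'^t* = S'.
  rewrite tr_diag_mx map_diag_mx.
  congr diag_mx; apply/rowP => k; rewrite !mxE.
  by apply/CrealP; rewrite realV ger0_real // sqrtC_ge0.
exists (A *m V^t* *m S'), S, V; split => //.
- apply/unitarymxP; apply: mulmx1C.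
  by rewrite trmx_mul map_mxM S'h mulmxA -[_ *m _ *m (A *m _)]mulmxA DE.
- exact: diag_mx_is_diag.
- by case/mulmx1_unit: SS.
- by rewrite -!mulmxA [S' *m _]mulmxA SS' mul1mx VV' mulmx1.
Qed.

(** * The Gell-Mann matrices form a basis *)

Section GellMann.
Variables (R : realType) (d : nat).

(** Vectorising turns spanning and independence into statements about the rank of one matrix. *)
Definition gell_mann_mx : 'M[R[i]]_(d ^ 2, d * d) :=
  \matrix_a mxvec (gell_mann R a).

Let spanned (A : 'M[R[i]]_d) := (mxvec A <= gell_mann_mx)%MS.

Let E (s t : nat) : 'M[R[i]]_d :=
  \matrix_(u, v) ((u == s :> nat) && (v == t :> nat))%:R.

Let spannedD A B : spanned A -> spanned B -> spanned (A + B).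
Proof. by rewrite /spanned linearD; apply: addmx_sub. Qed.

Let spannedZ c A : spanned A -> spanned (c *: A).
Proof. by rewrite /spanned linearZ; apply: scalemx_sub. Qed.

Let spannedZK c A : c != 0 -> spanned (c *: A) -> spanned A.
Proof. by move=> c0 /(spannedZ c^-1); rewrite scalerA mulVf ?scale1r. Qed.

Let spanned_gm a : spanned (gell_mann R a).
Proof. by rewrite /spanned -(rowK (fun a => mxvec (gell_mann R a))) row_sub. Qed.

Let gm_index p q : (p < d)%N -> (q < d)%N ->
  exists a : 'I_(d ^ 2),
    [/\ a = (p * d + q)%N :> nat, (a %/ d = p)%N & (a %% d = q)%N].
Proof.
move=> pd qd; have ad : (p * d + q < d ^ 2)%N.
  have /leq_trans-> // : (p * d + q < p.+1 * d)%N.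
    by rewrite mulSn addnC ltn_add2r.
  by rewrite leq_mul2r pd orbT.
exists (Ordinal ad); split=> //=.
  by rewrite divnMDl ?(leq_ltn_trans _ pd) // divn_small ?addn0.
by rewrite modnMDl modn_small.
Qed.

Let spanned_sym p q : (p < q)%N -> (q < d)%N -> spanned (E p q + E q p).
Proof.
move=> pq qd; have [a [aE a1 a2]] := gm_index p q (ltn_trans pq qd) qd.
suff <- : gell_mann R a = E p q + E q p by apply: spanned_gm.
by rewrite /gell_mann a1 a2 pq aE addn_eq0 (gtn_eqF (leq_ltn_trans _ pq)) ?andbF.
Qed.

Let spanned_anti p q : (p < q)%N -> (q < d)%N -> spanned ('i *: (E q p - E p q)).
Proof.
(* Antisymmetric matrices are listed at pairs whose first component is the larger one, hence the
   swapped arguments. *)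
move=> pq qd; have [a [aE a1 a2]] := gm_index q p qd (ltn_trans pq qd).
suff <- : gell_mann R a = 'i *: (E q p - E p q) by apply: spanned_gm.
rewrite /gell_mann a1 a2 pq ltnNge (ltnW pq) /= aE addn_eq0 muln_eq0.
have /gtn_eqF-> : (0 < q)%N by apply: leq_ltn_trans pq.
have /gtn_eqF-> : (0 < d)%N by apply: leq_ltn_trans qd.
by [].
Qed.

Let spanned_diag p : (0 < p)%N -> (p < d)%N ->
  spanned (\sum_(s < p) E s s - p%:R *: E p p).
Proof.
move=> p0 pd; have [a [aE a1 a2]] := gm_index p p pd pd.
(* The normalising constant is nonzero since [p > 0], so it does not affect the span. *)
apply: (@spannedZK (sqrtC (2 / (p * p.+1)%:R))).
  rewrite sqrtC_eq0 mulf_neq0 ?invr_eq0 ?pnatr_eq0 //.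
  by rewrite muln_eq0 negb_or -lt0n p0.
suff <- : gell_mann R a = sqrtC (2 / (p * p.+1)%:R) *:
    (\sum_(s < p) E s s - p%:R *: E p p) by apply: spanned_gm.
by rewrite /gell_mann a1 a2 ltnn aE addn_eq0 (gtn_eqF p0) andbF.
Qed.

Let spanned_id : (0 < d)%N -> spanned (\sum_(s < d) E s s).
Proof.
move=> d0; have a0 : (0 < d ^ 2)%N by rewrite expn_gt0 d0.
suff -> : \sum_(s < d) E s s = gell_mann R (Ordinal a0) by apply: spanned_gm.
rewrite /gell_mann /=; apply/matrixP => u v; rewrite summxE !mxE.
rewrite (bigD1 u) //= mxE eqxx /= big1 ?addr0 => [|s].
  by rewrite eq_sym.
by rewrite eq_sym -val_eqE mxE => /negbTE->.
Qed.

(* Eliminating E_pp between the p-th diagonal matrix and the partial identity of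
   rank p.+1 yields the partial identity of rank p. *)
Let spanned_pid k : (k <= d)%N -> spanned (\sum_(s < d - k) E s s).
Proof.
elim: k => [_|k IHk kd].
  rewrite subn0; case: (posnP d) => [d0|]; last exact: spanned_id.
  have -> : \sum_(s < d) E s s = 0.
    by rewrite big1 // => s _; have := ltn_ord s; rewrite [X in (_ < X)%N]d0.
  by rewrite /spanned linear0 sub0mx.
have {IHk} := IHk (ltnW kd).
set p := (d - k.+1)%N.
have -> : (d - k = p.+1)%N by rewrite /p subnS prednK ?subn_gt0.
have pd : (p < d)%N by rewrite ltn_subrL (leq_ltn_trans _ kd).
case: (posnP p) => [->|p0]; first by rewrite big_ord0 /spanned linear0 sub0mx.
move=> /(spannedZ p%:R) /(spannedD _ _ (spanned_diag p p0 pd)).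
rewrite big_ord_recr /= scalerDr addrACA addNr addr0.
rewrite -{1}[\sum__ _]scale1r -scalerDl.
by apply: spannedZK; rewrite nat1r pnatr_eq0.
Qed.

(** Off the diagonal, twice a matrix unit is the symmetric matrix plus ['i] or [- 'i] times the
    antisymmetric one. On the diagonal it is the difference of the partial identities of ranks
    [p.+1] and [p]. *)
Let spannedE p q : (p < d)%N -> (q < d)%N -> spanned (E p q).
Proof.
have two0 : (2 : R[i]) != 0 by rewrite pnatr_eq0.
move=> pd qd; case: (ltngtP p q) => [pq|qp|<-].
- apply: (spannedZK 2) => //.
  have := spannedD _ _ (spanned_sym p q pq qd)
    (spannedZ 'i _ (spanned_anti p q pq qd)).
  rewrite scalerA -expr2 sqrCi scaleN1r opprB addrACA subrr addr0.
  by rewrite scaler_nat mulr2n.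
- apply: (spannedZK 2) => //.
  have := spannedD _ _ (spanned_sym q p qp pd)
    (spannedZ (- 'i) _ (spanned_anti q p qp pd)).
  rewrite scalerA mulNr -expr2 sqrCi opprK scale1r addrC addrA subrK.
  by rewrite scaler_nat mulr2n.
have := spannedD _ _ (spanned_pid (d - p.+1) (leq_subr _ _))
  (spannedZ (-1) _ (spanned_pid (d - p) (leq_subr _ _))).
by rewrite !subKn ?(ltnW pd) // big_ord_recr /= scaleN1r addrAC subrr add0r.
Qed.

Lemma gell_mann_row_full : row_full gell_mann_mx.
Proof.
rewrite -sub1mx; apply/row_subP => k; case/mxvec_indexP: k => u v.
rewrite rowE mulmx1 -mxvec_delta.
suff -> : delta_mx u v = E u v by apply: spannedE.
by apply/matrixP => s t; rewrite !mxE.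
Qed.

(** There are as many matrices as dimensions, so spanning gives independence. *)
Lemma gell_mann_row_free : row_free gell_mann_mx.
Proof. by rewrite /row_free (eqP gell_mann_row_full) mulnn. Qed.

End GellMann.

(** * Conjugation in Gell-Mann coordinates *)

Section Transfer.
Variables (R : realType) (d : nat).

(** The equal sizes [d ^ 2] and [d * d] are spelled differently, so [pinvmx] stands for the inverse;
    it is two-sided because the matrix is both row free and row full. *)
Definition gm_coord (A : 'M[R[i]]_d) : 'rV[R[i]]_(d ^ 2) :=
  mxvec A *m pinvmx (gell_mann_mx R d).

Lemma gm_coordE A b : gm_coord A 0 b =
  \sum_u \sum_v A u v * pinvmx (gell_mann_mx R d) (mxvec_index u v) b.
Proof.
rewrite mxE pair_bigA (reindex _ (curry_mxvec_bij d d)) /=.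
by apply: eq_bigr => -[u v] _ /=; rewrite mxvecE.
Qed.

Lemma gm_coord_gell_mann a b : gm_coord (gell_mann R a) 0 b = (a == b)%:R.
Proof.
have /matrixP/(_ a b) := mulmxVp (gell_mann_row_free R d).
rewrite [RHS]mxE => <-.
by rewrite /gm_coord -(rowK (fun a => mxvec (gell_mann R a))) -row_mul mxE.
Qed.

Definition transfer (M : 'M[R[i]]_d) : 'M[R[i]]_(d ^ 2) :=
  \matrix_(b, a) gm_coord (M *m gell_mann R a *m M^t*) 0 b.

(** Up to a transpose, due to operators acting on row vectors, [transfer M] is the conjugation
    operator [L] after a change of basis; conjugation by the inverses of [M] and [M^t*] inverts
    it. *)
Lemma transfer_unit M : M \in unitmx -> transfer M \in unitmx.
Proof.
move=> uM; set G := gell_mann_mx R d.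
have uMh : M^t* \in unitmx by rewrite map_unitmx unitmx_tr.
pose L B B' := lin_mx (mulmxr B' \o mulmx B : 'M[R[i]]_d -> 'M[R[i]]_d).
have LM B B' A : mxvec A *m L B B' = mxvec (B *m A *m B') by rewrite mul_vec_lin.
have LL : L M (M^t*) *m L (invmx M) (invmx (M^t*)) = 1%:M.
  apply/row_matrixP => k; rewrite !rowE -[delta_mx 0 k]vec_mxK mulmxA !LM.
  by rewrite -!mulmxA mulmxV // mulmx1 !mulmxA mulVmx // mul1mx mulmx1.
have -> : transfer M = (G *m L M (M^t*) *m pinvmx G)^T.
  apply/matrixP => b a; rewrite [LHS]mxE [RHS]mxE.
  rewrite /gm_coord -LM -(rowK (fun a => mxvec (gell_mann R a))) -/G.
  by rewrite -!row_mul [LHS]mxE.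
rewrite unitmx_tr.
move: (pinvmx G) (mulmxVp (gell_mann_row_free R d))
  (mulVpmx (gell_mann_row_full R d)) => h Gh hG.
suff /mulmx1_unit[] : (G *m L M (M^t*) *m h) *m
  (G *m L (invmx M) (invmx (M^t*)) *m h) = 1%:M by [].
rewrite !mulmxA -[_ *m h *m G]mulmxA hG mulmx1.
by rewrite -[G *m _ *m _]mulmxA LL mulmx1.
Qed.

End Transfer.

(** * How coefficient tensors change under SLOCC operations *)

Section Coefficients.
Variables (R : realType) (N : nat) (d : 'I_N -> nat).
Hypothesis d_gt0 : forall k, (0 < d k)%N.

(** The tensor product of the [J k]-th coordinate functionals. Writing it on matrix entries defines
    it on all matrices, not only on pure tensors. *)
Definition tensor_coord (J : midx (dsq d))
    (Z : 'M[R[i]]_(\prod_(k < N) d k)) : R[i] :=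
  \sum_s \sum_t Z s t * \prod_k pinvmx (gell_mann_mx R (d k))
    (mxvec_index (decode d_gt0 s k) (decode d_gt0 t k)) (J k).

Lemma tensor_coord_tensor J A :
  tensor_coord J (tensor d_gt0 A) = \prod_k gm_coord R (d k) (A k) 0 (J k).
Proof.
under [RHS]eq_bigr do rewrite gm_coordE.
rewrite (encode_cond_distr _ _ _ d_gt0 xpredT); apply: eq_bigr => s _.
rewrite (encode_cond_distr _ _ _ d_gt0 xpredT); apply: eq_bigr => t _.
by rewrite mxE -big_split.
Qed.

Lemma tensor_coord_lin J (y : midx (dsq d) -> R[i]) A :
  tensor_coord J (\sum_I y I *: tensor d_gt0 (A I)) =
  \sum_I y I * \prod_k gm_coord R (d k) (A I k) 0 (J k).
Proof.
under [RHS]eq_bigr do rewrite -tensor_coord_tensor mulr_sumr.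
rewrite [RHS]exchange_big; apply: eq_bigr => s _ /=.
under [RHS]eq_bigr do rewrite mulr_sumr.
rewrite [RHS]exchange_big; apply: eq_bigr => t _ /=.
rewrite summxE mulr_suml; apply: eq_bigr => I _.
by rewrite mxE mulrA.
Qed.

Lemma tensorM A B : tensor d_gt0 A *m tensor d_gt0 B =
  tensor d_gt0 (fun k => A k *m B k) :> 'M[R[i]]_ _.
Proof. exact: kronM. Qed.

Lemma tensor_adj A : (tensor d_gt0 A)^t* =
  tensor d_gt0 (fun k => (A k)^t*) :> 'M[R[i]]_ _.
Proof.
apply/matrixP => s t; rewrite !mxE rmorph_prod; apply: eq_bigr => k _.
by rewrite !mxE.
Qed.

(** Apply the [J]-th coordinate functional to both expansions of the transformed state. It is dual
    to the product basis, so the expansion by [x'] leaves only [x' J], while each conjugated basis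
    tensor yields a product of [transfer] entries. *)
Lemma slocc_coef rho x x' (M : forall k, 'M[R[i]]_(d k)) J :
  coef_tensor d_gt0 rho x ->
  coef_tensor d_gt0 (tensor d_gt0 M *m rho *m (tensor d_gt0 M)^t*) x' ->
  (x' J)%:C%C = \sum_I (x I)%:C%C * \prod_k transfer R (d k) (M k) (J k) (I k).
Proof.
move=> rhoE rho'E; have := congr1 (tensor_coord J) rho'E; rewrite [in LHS]rhoE.
rewrite tensor_adj mulmx_sumr mulmx_suml.
under eq_bigr do rewrite -scalemxAr -scalemxAl !tensorM.
have coordE (I : midx (dsq d)) :
    \prod_k gm_coord R (d k) (gell_mann R (I k)) 0 (J k) = (I == J)%:R.
  have [->|IJ] := eqVneq I J.
    by apply: big1 => k _; rewrite gm_coord_gell_mann eqxx.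
  have [k /negbTE kIJ] : exists k, I k != J k.
    apply/existsP; apply: contraR IJ => /existsPn IJ; apply/eqP/ffunP => k.
    by apply/eqP; rewrite -[_ == _]negbK.
  by rewrite (bigD1 k) //= gm_coord_gell_mann kIJ mul0r.
rewrite !tensor_coord_lin; under [RHS]eq_bigr do rewrite coordE.
rewrite [RHS](bigD1 J) //= eqxx mulr1 [X in _ = _ + X]big1 => [|I /negbTE->].
  rewrite addr0 => <-.
  by apply: eq_bigr => I _; congr (_ * _); apply: eq_bigr => k _; rewrite [RHS]mxE.
by rewrite mulr0.
Qed.

End Coefficients.

(** * Matricization, and the rank of the realignment *)

Section Matricization.
Variables (N : nat) (e : 'I_N -> nat).
Hypothesis e_gt0 : forall k, (0 < e k)%N.

Lemma sum_midx_upd (V : nmodType) (f : midx e -> V) (n : 'I_N) :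
  \sum_I f I = \sum_(a < e n) \sum_(c < \prod_(k < N | k != n) e k)
    f (upd (decode e_gt0 c) a).
Proof.
rewrite pair_bigA /=.
rewrite (reindex (fun ac : 'I_(e n) * 'I_(\prod_(k < N | k != n) e k) =>
  upd (decode e_gt0 ac.2) ac.1)) //=.
exists (fun I : midx e => (I n, encode (fun k => k != n) I)) => [[a c] _|I _] /=.
  rewrite updE; congr pair; rewrite -[RHS](decodeK e_gt0).
  by apply: eq_encode => k kn; rewrite updNE.
apply/ffunP => k; have [->|kn] := eqVneq k n; first by rewrite updE.
by rewrite updNE // encodeK.
Qed.

(** The factor at mode [n] acts on the row index. The remaining factors depend only on the two
    column codes and form [kron], transposed because it acts from the right. *)
Lemma matricization_kron (F : comNzRingType) (y y' : midx e -> F)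
    (T : forall k, 'M[F]_(e k)) n :
  (forall J, y' J = \sum_I y I * \prod_k T k (J k) (I k)) ->
  matricization e_gt0 y' n = T n *m matricization e_gt0 y n *m
    (kron e_gt0 (fun k => k != n) T)^T.
Proof.
move=> y'E; apply/matrixP => a c; rewrite !mxE y'E (sum_midx_upd _ _ n).
rewrite exchange_big; apply: eq_bigr => c' _ /=.
rewrite mxE mulr_suml; apply: eq_bigr => b _.
rewrite !mxE (bigD1 n) //= !updE mulrCA mulrA; congr (_ * _).
by apply: eq_bigr => k kn; rewrite !updNE.
Qed.

Lemma kron_nonzero (F : fieldType) P (T : forall k, 'M[F]_(e k)) :
  (forall k, T k \in unitmx) -> exists s t, kron e_gt0 P T s t != 0.
Proof.
move=> uT; have u := kron_unit _ _ _ e_gt0 P T uT.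
(* Positive size excludes the empty matrix, which is both invertible and zero. *)
have n0 : (0 < \prod_(k < N | P k) e k)%N by apply: prodn_cond_gt0.
case: (pickP (fun st => kron e_gt0 P T st.1 st.2 != 0)) => [[s t] st|H].
  by exists s, t.
have k0 : kron e_gt0 P T = 0.
  by apply/matrixP => s t; rewrite [RHS]mxE; have /= := H (s, t) => /negbFE/eqP.
have := mxrank_unit u; rewrite k0 mxrank0 => n00.
by rewrite -n00 in n0.
Qed.

Lemma realign_bipartition_kron (F : fieldType) (T : forall k, 'M[F]_(e k)) i j :
  (forall k, T k \in unitmx) -> j != i ->
  \rank (realign (bipartition e_gt0 j
    (kron e_gt0 (fun k => k != i) T)^T)) = 1%N.
Proof.
move=> uT ji.
pose K := kron e_gt0 (fun k => (k != i) && (k != j)) T.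
set Z := realign _.
(* Row [(q, p)] comes from block [(p, q)] and column [(t, s)] from its entry [(s, t)]; the transpose
   of [kron] swaps both pairs back. *)
have ZE q p t s :
    Z (mxtens_index (q, p)) (mxtens_index (t, s)) = T j q p * K t s.
  rewrite mxE mxtens_indexK mxE mxE mxtens_indexK mxblockK !mxE.
  rewrite (bigD1 j) //= !encodeK // !updE; congr (_ * _).
  by apply: eq_bigr => k /andP[ki kj]; rewrite !encodeK // !updNE.
pose u : 'cV_(_) := \col_k T j (mxtens_unindex k).1 (mxtens_unindex k).2.
pose w : 'rV_(_) := \row_k K (mxtens_unindex k).1 (mxtens_unindex k).2.
have Zuw : Z = u *m w.
  apply/matrixP => k l.
  case: (mxtens_indexP k) => q p; case: (mxtens_indexP l) => t s.
  by rewrite ZE !mxE big_ord1 !mxE !mxtens_indexK.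
apply/eqP; rewrite eqn_leq; apply/andP; split.
  by rewrite Zuw (leq_trans (mxrankM_maxl _ _)) ?rank_leq_col.
have [t [s K0]] := kron_nonzero F (fun k => (k != i) && (k != j)) T uT.
(* A product over the single mode [j] provides a nonzero entry of [T j]. *)
have [t' [s' T0]] := kron_nonzero F (fun k => k == j) T uT.
rewrite mxE (big_pred1 j) // in T0.
rewrite lt0n mxrank_eq0; apply/eqP => Z0.
have /eqP := ZE (decode e_gt0 t' j) (decode e_gt0 s' j) t s.
by rewrite Z0 mxE eq_sym mulf_eq0 (negbTE T0) (negbTE K0).
Qed.

End Matricization.

Theorem theorem4 (R : realType) (N : nat) (d : 'I_N -> nat)
    (d_gt0 : forall k, (0 < d k)%N)
    (rho rho' : 'M[R[i]]_(\prod_(k < N) d k))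
    (x x' : midx (dsq d) -> R) :
  density rho -> density rho' ->
  coef_tensor d_gt0 rho x -> coef_tensor d_gt0 rho' x' ->
  slocc d_gt0 rho rho' ->
  forall i : 'I_N,
  let X := map_mx (real_complex R) (matricization (dsq_gt0 d_gt0) x i) in
  let X' := map_mx (real_complex R) (matricization (dsq_gt0 d_gt0) x' i) in
  exists P1 P2 S1 : 'M[R[i]]_(d i ^ 2),
  exists Q1 Q2 S2 : 'M[R[i]]_(\prod_(l < N | l != i) (d l ^ 2)),
    [/\ [/\ P1 \is unitarymx, P2 \is unitarymx,
            Q1 \is unitarymx & Q2 \is unitarymx],
        is_diag_mx S1 /\ S1 \in unitmx,
        is_diag_mx S2 /\ S2 \in unitmx,
        X' = P1 *m S1 *m P2^t* *m X *m Q2^t* *m S2 *m Q1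
      & forall j : 'I_N, j != i ->
          \rank (realign (bipartition (dsq_gt0 d_gt0) j
                            (Q2^t* *m S2 *m Q1))) = 1%N].
Proof.
move=> _ _ rhoE rho'E [M [uM rho'M]] i X X'.
rewrite {}rho'M in rho'E.
pose T k : 'M[R[i]]_(dsq d k) := transfer R (d k) (M k).
have uT k : T k \in unitmx by apply: transfer_unit.
(* [K] already includes the transpose: it is the whole right-hand factor. *)
pose K := (kron (dsq_gt0 d_gt0) (fun k => k != i) T)^T.
have uK : K \in unitmx by rewrite unitmx_tr kron_unit.
have X'E : X' = T i *m X *m K.
  have map_mat (y : midx (dsq d) -> R) :
      map_mx (real_complex R) (matricization (dsq_gt0 d_gt0) y i) =
      matricization (dsq_gt0 d_gt0) (real_complex R \o y) i.
    by apply/matrixP => a c; rewrite !mxE.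
  rewrite /X' /X !map_mat; apply: matricization_kron => J.
  exact: slocc_coef rhoE rho'E.
have [P [S [V [uP uV dS uS TE]]]] := unitmx_svd _ _ _ (uT i).
have [P' [S' [V' [uP' uV' dS' uS' KE]]]] := unitmx_svd _ _ _ uK.
(* The required form has adjoints on the inner unitary factors, so [V] and [P'] enter as adjoints.
   The product of the three right-hand factors is then exactly [K]. *)
exists P, (V^t*), S, V', (P'^t*), S'; split => //.
- by split; rewrite ?trmxC_unitary.
- by rewrite !trmxCK X'E TE KE !mulmxA.
- by move=> j ji; rewrite trmxCK -KE realign_bipartition_kron.
Qed.
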